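(* Let $n\ge2$, $\theta\in[0,2\pi)$, and let $C=C(\Sigma)$ be a regular cone in $\mathbb{C}^n$ with link $\Sigma\subset S^{2n-1}(1)$ of dimension $n-1$. Then $C$ is $\theta$-special Lagrangian if and only if $\Sigma$ is $\theta$-special Legendrian.
   Context: For a compact connected oriented embedded submanifold $\Sigma$ of the unit sphere, $C(\Sigma)=\{tx:t\ge0,\ x\in\Sigma\}$; a cone is regular if it is of this form, and $\Sigma$ is then its link. $C(\Sigma)\setminus\{0\}$ is oriented by $x\wedge\xi$, where $x$ is the outward radial direction and $\xi$ is the orientation of $\Sigma$. Let $\alpha_\theta=\operatorname{Re}(e^{i\theta}dz^1\wedge\dots\wedge dz^n)$. $C(\Sigma)$ is $\theta$-special Lagrangian if $\alpha_\theta$ restricts to the Riemannian volume form on $C(\Sigma)\setminus\{0\}$. Let $X$ be the Euler (radial) vector field on $\mathbb{C}^n$ and $\alpha_{\theta,N}=\iota_X\alpha_\theta$. An oriented $(n-1)$-dimensional submanifold $\Sigma$ of $S^{2n-1}(1)$ is $\theta$-special Legendrian if at each point of $\Sigma$, $\alpha_{\theta,N}$ restricts to the volume form on $\Sigma$. *)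

(* Defs.v *)
From HB Require Import structures.
From mathcomp Require Import all_boot all_order all_algebra.
From mathcomp Require Import complex.
From mathcomp Require Import all_classical all_reals all_analysis.

Set Implicit Arguments.
Unset Strict Implicit.
Unset Printing Implicit Defensive.

Import Order.TTheory GRing.Theory Num.Theory.
Import numFieldNormedType.Exports.

Local Open Scope classical_set_scope.
Local Open Scope ring_scope.

(* The library norm on 'rV[R]_N is the sup norm; it induces the usual topology
   but not the Euclidean metric, so the latter is introduced here. *)
Definition dotv (R : realType) (N : nat) (u v : 'rV[R]_N) : R :=
  \sum_(i < N) u 0 i * v 0 i.

Definition enorm (R : realType) (N : nat) (x : 'rV[R]_N) : R :=
  Num.sqrt (dotv x x).

Definition unit_sphere (R : realType) (N : nat) : set 'rV[R]_N :=
  [set x | enorm x = 1].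

Fixpoint Ck_on (R : realType) (V W : normedModType R) (k : nat)
    (U : set V) (f : V -> W) : Prop :=
  match k with
  | 0 => forall x, U x -> {for x, continuous f}
  | k'.+1 => (forall x, U x -> differentiable f x) /\
             (forall v, Ck_on k' U ('D_v f))
  end.

(* Meant for open U only. *)
Definition smooth_on (R : realType) (V W : normedModType R)
    (U : set V) (f : V -> W) : Prop := forall k, Ck_on k U f.

(* Slice charts: near each of its points, M is carried by a diffeomorphism
   Phi : U -> W (with inverse Psi) between open subsets of R^N onto
   W `&` (R^k x {0}). *)
Definition embedded_submanifold (R : realType) (N k : nat)
    (M : set 'rV[R]_N) : Prop :=
  (k <= N)%N /\
  forall p, M p -> exists (U W : set 'rV[R]_N) (Phi Psi : 'rV[R]_N -> 'rV[R]_N),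
    [/\ open U, open W & U p] /\
    [/\ smooth_on U Phi, smooth_on W Psi,
        (forall x, U x -> W (Phi x) /\ Psi (Phi x) = x) &
        (forall y, W y -> U (Psi y) /\ Phi (Psi y) = y)] /\
    (forall x, U x ->
       (M x <-> forall j : 'I_N, (k <= j)%N -> Phi x 0 j = 0)).

Definition tangent (R : realType) (N : nat) (M : set 'rV[R]_N)
    (p v : 'rV[R]_N) : Prop :=
  exists (e : R) (c : R -> 'rV[R]_N),
    [/\ 0 < e, smooth_on (ball (0 : R) e) c,
        (forall t, ball (0 : R) e t -> M (c t)), c 0 = p & derive1 c 0 = v].

(* A k-vector of R^N is given by its components xi I on the e_(I 0) /\ ... /\
   e_(I k.-1), for all multi-indices I (not only the increasing ones), that is,
   as an antisymmetric tensor.  Families of k vectors are the rows of a k x N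
   matrix. *)
Definition kvector (R : realType) (k N : nat) : Type :=
  {ffun 'I_k -> 'I_N} -> R.

Definition wedge (R : realType) (k N : nat) (v : 'M[R]_(k, N)) : kvector R k N :=
  fun I => \det (\matrix_(i < k, j < k) v i (I j)).

Definition wedge_cons (R : realType) (k N : nat) (x : 'rV[R]_N)
    (xi : kvector R k N) : kvector R k.+1 N :=
  fun I => \sum_(j < k.+1)
    (-1) ^+ j * x 0 (I j) * xi [ffun i : 'I_k => I (lift j i)].

(* The inner product for which the e_I, I increasing, are orthonormal: the
   factor k!^-1 compensates for summing over all multi-indices. *)
Definition kdot (R : realType) (k N : nat) (xi eta : kvector R k N) : R :=
  (k`!%:R)^-1 * \sum_(I : {ffun 'I_k -> 'I_N}) xi I * eta I.

(* An orientation is a continuous field of unit simple k-vectors, each being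
   the wedge of an orthonormal basis (the rows of E) of the tangent space. *)
Definition orientation (R : realType) (N k : nat) (M : set 'rV[R]_N)
    (xi : 'rV[R]_N -> kvector R k N) : Prop :=
  (forall p, M p -> exists E : 'M[R]_(k, N),
     [/\ (forall i j, dotv (row i E) (row j E) = (i == j)%:R),
         (forall v : 'rV[R]_N, tangent M p v <-> (v <= E)%MS) &
         xi p = wedge E]) /\
  (forall I, {within M, continuous (fun p => xi p I)}).

Definition dform (R : realType) (k N : nat) : Type :=
  'rV[R]_N -> 'M[R]_(k, N) -> R.

Definition interior_product (R : realType) (k N : nat)
    (X : 'rV[R]_N -> 'rV[R]_N) (w : dform R k.+1 N) : dform R k N :=
  fun p v => w p (col_mx (X p) v).

Definition euler (R : realType) (N : nat) : 'rV[R]_N -> 'rV[R]_N := id.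

(* If xi p is the wedge of an orthonormal basis E of the tangent space at p,
   then kdot (xi p) (wedge v) = det (dotv E_i v_j). *)
Definition volume_form (R : realType) (k N : nat)
    (xi : 'rV[R]_N -> kvector R k N) : dform R k N :=
  fun p v => kdot (xi p) (wedge v).

Definition restricts_to_volume (R : realType) (k N : nat) (w : dform R k N)
    (M : set 'rV[R]_N) (xi : 'rV[R]_N -> kvector R k N) : Prop :=
  forall p, M p -> forall v : 'M[R]_(k, N),
    (forall i, tangent M p (row i v)) -> w p v = volume_form xi p v.

(* C^n is R^(n + n), (x, y) standing for x + i y. *)
Definition dz (R : realType) (n : nat) (j : 'I_n) (v : 'rV[R]_(n + n)) :
    R[i] :=
  Complex (v 0 (lshift n j)) (v 0 (rshift n j)).

Definition cexp_i (R : realType) (theta : R) : R[i] :=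
  Complex (cos theta) (sin theta).

Definition alpha (R : realType) (n : nat) (theta : R) : dform R n (n + n) :=
  fun _ v => complex.Re (cexp_i theta *
    \det (\matrix_(i < n, j < n) dz j (row i v))).

Definition alphaN (R : realType) (m : nat) (theta : R) :
    dform R m (m.+1 + m.+1) :=
  interior_product (@euler R _) (@alpha R m.+1 theta).

Definition cone (R : realType) (N : nat) (S : set 'rV[R]_N) : set 'rV[R]_N :=
  [set y | exists t x, [/\ 0 <= t, S x & y = t *: x]].

(* S, of dimension m and oriented by xi, is the link of a regular cone. *)
Definition regular_link (R : realType) (N m : nat) (S : set 'rV[R]_N)
    (xi : 'rV[R]_N -> kvector R m N) : Prop :=
  [/\ S `<=` @unit_sphere R N, compact S, connected S,
      embedded_submanifold m S & orientation S xi].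

Definition cone_orientation (R : realType) (N m : nat)
    (xi : 'rV[R]_N -> kvector R m N) : 'rV[R]_N -> kvector R m.+1 N :=
  fun y => let x := (enorm y)^-1 *: y in wedge_cons x (xi x).

Definition special_lagrangian_cone (R : realType) (m : nat) (theta : R)
    (S : set 'rV[R]_(m.+1 + m.+1))
    (xi : 'rV[R]_(m.+1 + m.+1) -> kvector R m (m.+1 + m.+1)) : Prop :=
  restricts_to_volume (@alpha R m.+1 theta) (cone S `\ 0) (cone_orientation xi).

Definition special_legendrian (R : realType) (m : nat) (theta : R)
    (S : set 'rV[R]_(m.+1 + m.+1))
    (xi : 'rV[R]_(m.+1 + m.+1) -> kvector R m (m.+1 + m.+1)) : Prop :=
  restricts_to_volume (@alphaN R m theta) S xi.

(* Main.v *)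
(* At a point y = t x of the cone (t > 0, |x| = 1), the tangent space of the
   cone is spanned by x and the tangent space of the link at x, which is
   orthogonal to x.  Both alpha_theta and the volume form of the cone are
   alternating forms of top degree on that space, and alpha_theta has constant
   coefficients, so they agree at y if and only if they agree on one basis
   (x, E_1, ..., E_m) with E tangent to the link; there they become
   alpha_(theta, N) and the volume form of the link at x evaluated on E. *)
Require Import Defs.
From mathcomp Require Import all_boot all_order all_algebra all_fingroup.
From mathcomp Require Import complex.
From mathcomp Require Import all_classical all_reals all_analysis.

Set Implicit Arguments.
Unset Strict Implicit.
Unset Printing Implicit Defensive.

Import Order.TTheory GRing.Theory Num.Theory.
Import numFieldNormedType.Exports.

Local Open Scope classical_set_scope.
Local Open Scope ring_scope.

(** * Determinants, multivectors and the form [alpha] *)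

Section multilinear.
Context {R : realType}.

(** This is Laplace expansion along the first row. *)
Lemma wedge_cons_wedge (k N : nat) (x : 'rV[R]_N) (E : 'M[R]_(k, N)) :
  wedge_cons x (wedge E) = wedge (col_mx x E : 'M[R]_(k.+1, N)).
Proof.
apply/funext => I; rewrite /wedge /wedge_cons (expand_det_row _ ord0).
apply: eq_bigr => j _; rewrite /cofactor add0n !mxE mulrA.
rewrite [_ * x _ _]mulrC; congr (_ * _ * _).
  by case: splitP => [i _|//]; rewrite ord1.
congr determinant; apply/matrixP => a b; rewrite !mxE ffunE.
case: splitP => [i|i /= [/val_inj ->]] //=.
by rewrite ord1.
Qed.

(** In the Leibniz formula the product of sums distributes into a sum over all multi-indices. Only
    [B] is antisymmetrised here: this is half of Cauchy-Binet. *)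
Lemma det_mul_tr_wedge (k N : nat) (A B : 'M[R]_(k, N)) :
  \det (A *m B^T) =
  \sum_(I : {ffun 'I_k -> 'I_N}) (\prod_i A i (I i)) * wedge B I.
Proof.
rewrite /determinant.
under eq_bigr => s _.
  under eq_bigr => i _ do rewrite mxE.
  rewrite bigA_distr_bigA /= mulr_sumr.
  over.
rewrite exchange_big /=; apply: eq_bigr => I _.
rewrite /wedge -det_tr /determinant mulr_sumr; apply: eq_bigr => s _.
rewrite mulrCA big_split /=; congr (_ * (_ * _)).
by apply: eq_bigr => i _; rewrite !mxE.
Qed.

(* Cauchy-Binet, summed over all multi-indices instead of the increasing ones. *)
Lemma kdot_wedge (k N : nat) (A B : 'M[R]_(k, N)) :
  kdot (wedge A) (wedge B) = \det (A *m B^T).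
Proof.
rewrite /kdot; set T := \det _.
suff -> : \sum_I wedge A I * wedge B I = k`!%:R * T.
  by rewrite mulKf // pnatr_eq0 -lt0n fact_gt0.
rewrite {1}/wedge /determinant.
under eq_bigr => I _ do rewrite mulr_suml.
rewrite exchange_big /=.
(* All [k!] permutations in the Leibniz expansion of [wedge A] contribute the same [T]: relabelling
   [I] by the inverse of [s] makes the product diagonal and permutes the columns in [wedge B], whose
   sign cancels that of [s]. *)
have perms (s : {perm 'I_k}) : \sum_(I : {ffun 'I_k -> 'I_N})
    (-1) ^+ s * (\prod_i (\matrix_(i, j) A i (I j)) i (s i)) * wedge B I = T.
  rewrite /T det_mul_tr_wedge.
  rewrite (reindex_inj (h := fun I : {ffun 'I_k -> 'I_N} =>
             [ffun i => I ((s^-1)%g i)])) /=; last first.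
    move=> I J /ffunP IJ; apply/ffunP => i.
    by have := IJ (s i); rewrite !ffunE permK.
  apply: eq_bigr => I _; rewrite mulrAC mulrC; congr (_ * _).
    by apply: eq_bigr => i _; rewrite !mxE ffunE permK.
  rewrite /wedge (_ : (\matrix_(i, j) B i ([ffun i0 => I ((s^-1)%g i0)] j)) =
    (\matrix_(i, j) B i (I j)) *m perm_mx s).
    by rewrite det_mulmx det_perm mulrCA -expr2 sqrr_sign mulr1.
  rewrite -[s]invgK -col_permE; apply/matrixP => i j.
  by rewrite !mxE ffunE invgK.
under eq_bigr => s _ do rewrite perms.
by rewrite sumr_const card_Sn mulr_natl.
Qed.

Definition dzmx (k n : nat) (v : 'M[R]_(k, n + n)) : 'M[R[i]]_(k, n) :=
  \matrix_(i, j) dz j (row i v).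

(** Each [dz j] is real-linear: splitting into real and imaginary parts reduces the claim to
    products of [A] with two real blocks. *)
Lemma dzmx_mul (k l n : nat) (A : 'M[R]_(k, l)) (v : 'M[R]_(l, n + n)) :
  dzmx (A *m v) = map_mx (real_complex R) A *m dzmx v.
Proof.
have dzE a (w : 'M[R]_(a, n + n)) : dzmx w =
    map_mx (real_complex R) (lsubmx w)
    + Complex 0 1 *: map_mx (real_complex R) (rsubmx w).
  apply/matrixP => i j; rewrite !mxE /dz !mxE.
  by apply/eqP; rewrite eq_complex /= !(mul0r, mul1r, mulr0, addr0, add0r, subr0) !eqxx.
by rewrite !dzE mulmxDr -scalemxAr -!map_mxM -mulmx_lsub -mulmx_rsub.
Qed.

(** The determinant of the real matrix [A] is real, so it can be pulled out of [complex.Re]. *)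
Lemma alpha_mul (n : nat) (theta : R) p (A : 'M[R]_n) (v : 'M[R]_(n, n + n)) :
  alpha theta p (A *m v) = \det A * alpha theta p v.
Proof.
rewrite /alpha -!/(dzmx _) dzmx_mul det_mulmx det_map_mx.
case: (cexp_i theta) (\det (dzmx v)) => [a b] [c d] /=.
by rewrite !mul0r subr0 addr0 mulrBr !(mulrCA (\det A)).
Qed.

Lemma dotvE (N : nat) (u v : 'rV[R]_N) : dotv u v = (u *m v^T) 0 0.
Proof. by rewrite mxE; apply: eq_bigr => i _; rewrite mxE. Qed.

(** The Gram matrix is block lower triangular with corner entry 1: adjoining the radial unit vector
    does not change the volume. *)
Lemma det_gram_col_mx (k N : nat) (p : 'rV[R]_N) (E v : 'M[R]_(k, N)) :
  dotv p p = 1 -> (forall i, dotv p (row i v) = 0) ->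
  \det (col_mx p E *m (col_mx p v)^T) = \det (E *m v^T).
Proof.
move=> p1 pv; rewrite tr_col_mx mul_col_row.
have -> : p *m v^T = 0.
  apply/rowP => j; rewrite [RHS]mxE -(pv j) mxE.
  by apply: eq_bigr => i _; rewrite !mxE.
by rewrite det_lblock det_mx11 -dotvE p1 mul1r.
Qed.

End multilinear.

(** * Chain and product rules for curves *)

Section derivatives_of_curves.
Context {R : realType}.

(** The direction [v] stays arbitrary because [Ck_on] differentiates along every direction, even on
    the line. *)
Lemma is_derive_comp_curve (g h : R -> R) (x v a : R) :
  is_derive (h x) 1 g a -> differentiable h x ->
  is_derive x v (g \o h) ('D_v h x * a).
Proof.
move=> [gd ga] hd.
have gdiff : differentiable g (h x) by exact/derivable1_diffP.
have ghd : differentiable (g \o h) x by exact: differentiable_comp.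
split; first exact: diff_derivable.
have E1 := deriveE v ghd.
have E2 := deriveE v hd.
have E3 : 'd (g \o h) x v = 'd g (h x) ('d h x v).
  exact: (f_equal (fun F => F v) (diff_comp hd gdiff)).
have E4 := f_equal (fun F => F ('d h x v)) (deriv1E gd).
apply: (etrans E1); apply: (etrans E3); apply: (etrans E4).
apply: (etrans (f_equal (fun z => _ *: z) (derive1E g (h x)))).
exact: (congr2 _ (esym E2) ga).
Qed.

(** The derivative is expressed through the cube of the function itself, the form needed for an
    induction on the order of regularity. *)
Lemma is_derive_invsqrt (y : R) : 0 < y ->
  is_derive y 1 (fun z => (Num.sqrt z)^-1) (- 2^-1 * (Num.sqrt y)^-1 ^+ 3).
Proof.
move=> y0; have sy0 : Num.sqrt y != 0 by rewrite gt_eqF // sqrtr_gt0.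
have [sd sE] := is_derive1_sqrt y0.
split; first exact: derivableV.
apply: (etrans (deriveV sy0 sd)); apply: (etrans (f_equal (fun z => _ *: z) sE)).
rewrite -[LHS]/(- (Num.sqrt y) ^- 2 * (2 * Num.sqrt y)^-1).
by rewrite -exprVn invfM !mulNr mulrCA -exprSr.
Qed.

Lemma is_derive_rsqrt (h : R -> R) (x v : R) : 0 < h x ->
  differentiable h x ->
  is_derive x v (fun y => (Num.sqrt (h y))^-1)
    ('D_v h x * (- 2^-1 * (Num.sqrt (h x))^-1 ^+ 3)).
Proof. by move=> /is_derive_invsqrt; exact: is_derive_comp_curve. Qed.

Context {n : nat}.
Implicit Types (r : R -> R) (f : R -> 'rV[R]_n) (t v : R).

Lemma is_deriveZ_curve r f t v : derivable r t v -> derivable f t v ->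
  is_derive t v (fun s => r s *: f s) ('D_v r t *: f t + r t *: 'D_v f t).
Proof.
move=> rd fd; have fi := (derivable_mxP _ _ _).1 fd 0.
have coordE i : (fun s => (r s *: f s) 0 i) = r * (fun s => f s 0 i).
  by apply/funext => s; rewrite mxE.
have rfd : derivable (fun s => r s *: f s) t v.
  apply/derivable_mxP => j i.
  by rewrite ord1; move: (derivableM rd (fi i)); rewrite -(coordE i).
split=> //; rewrite (derive_mx rfd) (derive_mx fd); apply/rowP => i.
rewrite !mxE coordE (deriveM rd (fi i)) addrC; congr (_ + _).
exact: mulrC.
Qed.

Lemma is_derive_dotv f t v : derivable f t v ->
  is_derive t v (fun s => dotv (f s) (f s)) (2 * dotv (f t) ('D_v f t)).
Proof.
move=> fd; have fi := (derivable_mxP _ _ _).1 fd 0.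
have -> : (fun s => dotv (f s) (f s)) =
    \sum_(i < n) ((fun s => f s 0 i) * (fun s => f s 0 i)).
  by apply/funext => s; rewrite fct_sumE.
have d2 i := derivableM (fi i) (fi i).
split; first exact: derivable_sum.
rewrite (derive_sum d2).
rewrite /dotv mulr_sumr; apply: eq_bigr => i _.
rewrite (deriveM (fi i) (fi i)).
by rewrite (derive_mx fd) mxE mulr_natl mulr2n.
Qed.

End derivatives_of_curves.

(** * Closure properties of C^k curves on an open set of the line *)

Section smooth_curves.
Context {R : realType} {U : set R} (Uo : open U).

(** Derivatives at a point of the open set [U] see only nearby values. The inductions below use this
    to replace a derivative by a formula valid only on [U]. *)
Lemma Ck_on_eq (W : normedModType R) k (f g : R -> W) :
  (forall x, U x -> f x = g x) -> Ck_on k U f -> Ck_on k U g.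
Proof.
move=> + + ; elim: k f g => [|k IH] f g fg /=.
  move=> fc x Ux; have nfg : {near x, f =1 g}.
    by apply: filterS (open_nbhs_nbhs (conj Uo Ux)) => y; exact: fg.
  rewrite /prop_for /continuous_at -(fg _ Ux).
  apply: cvg_trans (fc x Ux); apply: near_eq_cvg.
  exact: nfg.
have nfg x : U x -> {near x, f =1 g}.
  by move=> Ux; apply: filterS (open_nbhs_nbhs (conj Uo Ux)) => y; exact: fg.
move=> [fd fC]; split => [x Ux|v].
  have /derivable1_diffP fx := fd x Ux.
  by apply/derivable1_diffP; exact: near_eq_derivable (nfg x Ux) fx.
apply: IH (fC v) => x Ux; exact: near_eq_derive (nfg x Ux).
Qed.

Lemma Ck_onS (W : normedModType R) k (f : R -> W) :
  Ck_on k.+1 U f -> Ck_on k U f.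
Proof.
elim: k f => [|k IH] f [fd fC]; last by split=> // v; exact: IH.
by move=> x Ux; apply/differentiable_continuous/fd.
Qed.

Lemma Ck_on_cst (W : normedModType R) k (a : W) : Ck_on k U (cst a).
Proof.
elim: k a => [|k IH] a /=; first by move=> x _; exact: cst_continuous.
split=> [x _|v]; first exact: differentiable_cst.
by apply: (@Ck_on_eq _ _ (cst 0)) (IH 0) => x _; rewrite derive_cst.
Qed.

Lemma Ck_on_id k : Ck_on k U (id : R -> R).
Proof.
case: k => [|k] /=; first by move=> x _; exact: cvg_id.
split=> [x _|v]; first exact/derivable1_diffP.
by apply: (@Ck_on_eq _ _ (cst v)) (Ck_on_cst k v) => x _; rewrite derive_id.
Qed.

Lemma Ck_onD (W : normedModType R) k (f g : R -> W) :
  Ck_on k U f -> Ck_on k U g -> Ck_on k U (f + g).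
Proof.
elim: k f g => [|k IH] f g /=.
  by move=> fc gc x Ux; apply: continuousD; [exact: fc|exact: gc].
move=> [fd fC] [gd gC]; split=> [x Ux|v].
  by apply: differentiableD; [exact: fd|exact: gd].
apply: (@Ck_on_eq _ _ ('D_v f + 'D_v g)); last exact: IH.
by move=> x Ux; rewrite deriveD //; apply: diff_derivable; [exact: fd|exact: gd].
Qed.

Lemma Ck_onM k (f g : R -> R) :
  Ck_on k U f -> Ck_on k U g -> Ck_on k U (f * g).
Proof.
elim: k f g => [|k IH] f g.
  by move=> fc gc x Ux; apply: continuousM; [exact: fc|exact: gc].
move=> fk gk; have [[fd fC] [gd gC]] := (fk, gk); split=> [x Ux|v].
  by apply: differentiableM; [exact: fd|exact: gd].
apply: (@Ck_on_eq _ _ (f * 'D_v g + g * 'D_v f)).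
  by move=> x Ux; rewrite deriveM //; apply: diff_derivable; [exact: fd|exact: gd].
(* The Leibniz formula also contains [f] and [g] themselves, whose order must be lowered to [k] to
   apply the induction hypothesis. *)
have [fS gS] := (Ck_onS fk, Ck_onS gk).
by apply: Ck_onD; apply: IH => //; [exact: (gC v)|exact: (fC v)].
Qed.

Lemma Ck_on_sum k n (f : 'I_n -> R -> R) :
  (forall i, Ck_on k U (f i)) -> Ck_on k U (\sum_(i < n) f i).
Proof.
move=> fk; elim/big_ind: _ => [|g h|i _]; last exact: fk.
- exact: Ck_on_cst.
- exact: Ck_onD.
Qed.

(* r = 1 / sqrt h satisfies r' = - r^3 h' / 2, so its regularity bootstraps. *)
Lemma Ck_on_rsqrt k (h : R -> R) : (forall x, U x -> 0 < h x) ->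
  Ck_on k U h -> Ck_on k U (fun x => (Num.sqrt (h x))^-1).
Proof.
move=> h0; elim: k => [|k IH] hk.
  move=> x Ux; apply: continuousV; first by rewrite gt_eqF // sqrtr_gt0 h0.
  apply: continuous_comp; [exact: hk|exact: sqrt_continuous].
have [hd hC] := hk; have rk := IH (Ck_onS hk); split => [x Ux|v].
  apply/derivable1_diffP.
  by have [] := is_derive_rsqrt 1 (h0 x Ux) (hd x Ux).
set r := (fun x => _) in rk *.
apply: (@Ck_on_eq _ _ (cst (- 2^-1) * (r * r * r) * 'D_v h)).
  move=> x Ux; have [_ ->] := is_derive_rsqrt v (h0 x Ux) (hd x Ux).
  by rewrite !fctE /r !exprS expr0 mulr1 [RHS]mulrC !mulrA.
apply: Ck_onM; last exact: (hC v).
by apply: Ck_onM; [exact: Ck_on_cst|do !apply: Ck_onM].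
Qed.

Lemma Ck_on_coordP k n (f : R -> 'rV[R]_n) :
  Ck_on k U f <-> forall i, Ck_on k U (fun x => f x 0 i).
Proof.
have diffP (g : R -> 'rV[R]_n) x :
    differentiable g x <-> forall i, differentiable (fun y => g y 0 i) x.
  split=> [gd i|gd]; last first.
    apply/derivable1_diffP/derivable_mxP => j i; rewrite ord1.
    exact/derivable1_diffP.
  by apply/derivable1_diffP; move/derivable1_diffP/derivable_mxP: gd; exact.
elim: k f => [|k IH] f.
  split=> [fc i x Ux|fc x Ux].
    apply: (@continuous_comp _ _ _ f (fun M : 'rV[R]_n => M 0 i)).
      exact: fc.
    exact: coord_continuous.
  (* The sup norm is at most [e] once each of the finitely many coordinates is. *)
  apply/cvgrPdist_le => e e0; near=> y.
  rewrite /Num.Def.normr/= mx_normrE (bigmax_le _ (ltW e0))//= => i _.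
  rewrite !mxE; move: i; near: y; apply: filter_forall => -[j i] /=.
  by rewrite ord1; exact: (cvgrPdist_le _ _).1 (fc i x Ux) e e0.
have DE (v : R) i x : differentiable f x ->
    'D_v f x 0 i = 'D_v (fun x => f x 0 i) x.
  by move=> fd; rewrite derive_mx ?mxE //; exact: diff_derivable.
split=> [[fd fC] i|fC].
  split=> [x Ux|v]; first exact: (diffP f x).1 (fd x Ux) i.
  have /IH/(_ i) := fC v; apply: Ck_on_eq => x Ux.
  by rewrite DE //; exact: fd.
have fd x : U x -> differentiable f x.
  by move=> Ux; apply/diffP => i; have [+ _] := fC i; exact.
split=> // v; apply/IH => i; have [_ /(_ v)] := fC i; apply: Ck_on_eq => x Ux.
by rewrite DE //; exact: fd.
Unshelve. all: by end_near. Qed.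

Lemma Ck_onZ k n (r : R -> R) (f : R -> 'rV[R]_n) :
  Ck_on k U r -> Ck_on k U f -> Ck_on k U (fun t => r t *: f t).
Proof.
move=> rk /Ck_on_coordP fk; apply/Ck_on_coordP => i.
apply: Ck_on_eq (Ck_onM rk (fk i)) => t _.
by rewrite mxE.
Qed.

Lemma Ck_on_dotv k n (f : R -> 'rV[R]_n) :
  Ck_on k U f -> Ck_on k U (fun t => dotv (f t) (f t)).
Proof.
move=> /Ck_on_coordP fk.
apply: Ck_on_eq (Ck_on_sum (fun i => Ck_onM (fk i) (fk i))) => t _.
by rewrite fct_sumE.
Qed.

Lemma smooth_curve_derivable (W : normedModType R) (f : R -> W) (t v : R) :
  smooth_on U f -> U t -> derivable f t v.
Proof. by move=> /(_ 1%N)[fd _] /fd; exact: diff_derivable. Qed.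

End smooth_curves.

(** * Tangent vectors of the cone and of its link *)

Section cone.
Context {R : realType} {N : nat}.
Implicit Types (S : set 'rV[R]_N) (p v y : 'rV[R]_N).

Lemma dotv_gt0 v : v != 0 -> 0 < dotv v v.
Proof.
move=> v0; rewrite lt_def; apply/andP; split; last first.
  by apply: sumr_ge0 => i _; rewrite -expr2 sqr_ge0.
apply: contra v0 => /eqP vv; apply/eqP/rowP => i; rewrite mxE.
have vi : v 0 i * v 0 i = 0.
  by apply: (psumr_eq0P _ vv) => // j _; rewrite -expr2 sqr_ge0.
by apply/eqP; rewrite -sqrf_eq0 expr2 vi.
Qed.

Lemma enormZ (t : R) v : 0 <= t -> enorm (t *: v) = t * enorm v.
Proof.
move=> t0; rewrite /enorm [dotv _ _](_ : _ = t ^+ 2 * dotv v v).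
  by rewrite sqrtrM ?sqr_ge0 // sqrtr_sqr ger0_norm.
by rewrite /dotv mulr_sumr; apply: eq_bigr => i _; rewrite !mxE mulrACA expr2.
Qed.

Lemma unit_sphere_dotv p : unit_sphere p -> dotv p p = 1.
Proof.
rewrite /unit_sphere /= /enorm => p1.
(* [Num.sqrt] is 0 on nonpositive numbers, so a root equal to 1 excludes a negative argument. *)
have p0 : 0 <= dotv p p.
  by rewrite leNgt; apply/negP => /ltW /ler0_sqrtr p0; move/eqP: p1; rewrite p0 eq_sym oner_eq0.
by rewrite -[LHS]sqr_sqrtr // p1 expr1n.
Qed.

Lemma coneD0P S y : S `<=` @unit_sphere R N -> (cone S `\ 0) y ->
  [/\ 0 < enorm y, S ((enorm y)^-1 *: y) & y != 0].
Proof.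
move=> Ssph [[t [x [t0 Sx ->]]] /eqP y0].
have t0' : 0 < t.
  by rewrite lt_def t0 andbT; apply: contra y0 => /eqP ->; rewrite scale0r.
rewrite enormZ // (Ssph _ Sx) mulr1; split=> //.
by rewrite scalerA mulVf ?gt_eqF // scale1r.
Qed.

Lemma sub_coneD0 S p (t : R) : S `<=` @unit_sphere R N -> S p -> 0 < t ->
  (cone S `\ 0) (t *: p).
Proof.
move=> Ssph Sp t0; split; first by exists t, p; split => //; exact: ltW.
move=> /eqP; rewrite scaler_eq0 gt_eqF //= => /eqP p0.
have /eqP := Ssph _ Sp; rewrite p0 /enorm /dotv big1 ?sqrtr0 1?eq_sym ?oner_eq0 //.
by move=> i _; rewrite mxE mul0r.
Qed.

Lemma tangentS S S' p v : S `<=` S' -> tangent S p v -> tangent S' p v.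
Proof.
by move=> SS' [e [c [e0 cs cS c0 cv]]]; exists e, c; split=> // t /cS /SS'.
Qed.

(** The curve is the ray through [p], parametrised by [(1 + t) *: p]; on the unit ball the factor is
    positive, so the apex is avoided. *)
Lemma tangent_cone_radial S p : S `<=` @unit_sphere R N -> S p ->
  tangent (cone S `\ 0) p p.
Proof.
move=> Ssph Sp; exists 1, (fun t => (1 + t) *: p); split.
- exact: ltr01.
- have Uo : open (ball (0 : R) 1) by exact: ball_open.
  move=> k.
  have rk : Ck_on k (ball (0 : R) 1) (cst 1 + id : R -> R).
    by apply: (Ck_onD Uo); [exact: (Ck_on_cst Uo)|exact: (Ck_on_id Uo)].
  exact: (Ck_onZ Uo rk (Ck_on_cst Uo k p)).
- move=> t; rewrite -ball_normE /= sub0r normrN => /ltr_normlP[t1 _].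
  by apply: sub_coneD0 => //; rewrite -ltrBlDl sub0r ltrNl.
- by rewrite addr0 scale1r.
- rewrite derive1E; have [_ ->] := is_deriveZ_curve (n := N) (r := cst 1 + id)
    (f := cst p) (t := 0) (v := 1) ltac:(done) ltac:(done).
  by rewrite derive_cst scaler0 addr0 deriveD // derive_cst derive_id add0r scale1r.
Qed.

(** Differentiate the constant function [dotv (c t) (c t) = 1] at 0. *)
Lemma tangent_sphere_orthogonal S p v : S `<=` @unit_sphere R N ->
  tangent S p v -> dotv p v = 0.
Proof.
move=> Ssph [e [c [e0 cs cS <- <-]]].
have b0 : ball (0 : R) e 0 by exact: ballxx.
have cd : derivable c 0 1 by exact: smooth_curve_derivable cs b0.
have [_] := is_derive_dotv cd.
rewrite (near_eq_derive (g := cst 1 : R -> R)); last first.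
  by apply: filterS (nbhsx_ballx _ _ e0) => t /cS /Ssph; exact: unit_sphere_dotv.
by rewrite derive_cst derive1E => /esym/eqP; rewrite mulf_eq0 pnatr_eq0 /= => /eqP.
Qed.

(* The radial projection c / |c| of a curve c in the cone is a curve in the
   link; its velocity at 0 has the displayed form with a = (1 / |c|)'(0). *)
Lemma tangent_coneD0 S y v : S `<=` @unit_sphere R N ->
  tangent (cone S `\ 0) y v ->
  exists a, tangent S ((enorm y)^-1 *: y) (a *: y + (enorm y)^-1 *: v).
Proof.
move=> Ssph [e [c [e0 cs cS <- <-]]]; have Uo : open (ball (0 : R) e) by exact: ball_open.
have b0 : ball (0 : R) e 0 by exact: ballxx.
pose r t := (enorm (c t))^-1.
have rs : smooth_on (ball (0 : R) e) r.
  move=> k; apply: Ck_on_rsqrt => //; last exact: Ck_on_dotv.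
  by move=> t /cS /(coneD0P Ssph) [_ _ ?]; exact: dotv_gt0.
exists ('D_1 r 0), e, (fun t => r t *: c t); split=> //.
- by move=> k; exact: Ck_onZ.
- by move=> t /cS /(coneD0P Ssph) [].
rewrite !derive1E; apply: derive_val; apply: is_deriveZ_curve.
  exact: smooth_curve_derivable rs b0.
exact: smooth_curve_derivable cs b0.
Qed.

End cone.

Theorem proposition2p5 (R : realType) (m : nat) (hn : (2 <= m.+1)%N)
    (theta : R) (htheta : 0 <= theta < 2 * pi)
    (S : set 'rV[R]_(m.+1 + m.+1))
    (xi : 'rV[R]_(m.+1 + m.+1) -> kvector R m (m.+1 + m.+1))
    (hS : regular_link S xi) :
  special_lagrangian_cone theta S xi <-> special_legendrian theta S xi.
Proof.
have [Ssph _ _ _ [Sxi _]] := hS; split=> H.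
  move=> p Sp v vS; have [E [_ ES xiE]] := Sxi p Sp.
  have Cp : (cone S `\ 0) p by rewrite -[p]scale1r; exact: sub_coneD0.
  have pv_tangent (i : 'I_(1 + m)) : tangent (cone S `\ 0) p (row i (col_mx p v)).
    rewrite -(splitK i); case: (fintype.split i) => j /=.
      rewrite rowKu (_ : row j p = p); first exact: tangent_cone_radial.
      by apply/rowP => l; rewrite mxE ord1.
    rewrite rowKd; apply: tangentS (vS j) => x Sx.
    by rewrite -[x]scale1r; exact: sub_coneD0.
  (* [alphaN] at [p] unfolds to [alpha] on the rows of [col_mx p v]; since [p] has norm 1, the
     normalisation in [cone_orientation] is then trivial. *)
  rewrite -[LHS]/(alpha theta p (col_mx p v)) (H p Cp _ pv_tangent).
  rewrite /volume_form /cone_orientation (Ssph p Sp) invr1 scale1r xiE.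
  rewrite wedge_cons_wedge !kdot_wedge det_gram_col_mx //.
    exact/unit_sphere_dotv/Ssph.
  by move=> i; exact: tangent_sphere_orthogonal (vS i).
move=> y Cy v vC; have [y0 Sp _] := coneD0P Ssph Cy.
have [E [_ ES xiE]] := Sxi _ Sp.
have ET i := (ES _).2 (row_sub i E).
have EH := H _ Sp E ET.
(* Up to the nonzero factor [(enorm y)^-1], a row of [v] is a vector tangent to the link, hence in
   the span of [E], minus the radial vector [a *: y]. *)
have vpE : (v <= col_mx ((enorm y)^-1 *: y) E)%MS.
  apply/row_subP => i; have [a /ES aE] := tangent_coneD0 Ssph (vC i).
  have yE : (a *: y <= ((enorm y)^-1 *: y))%MS.
    by rewrite scalemx_sub // -(eqmx_scale y (invr_neq0 (lt0r_neq0 y0))).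
  rewrite -(eqmx_scale _ (invr_neq0 (lt0r_neq0 y0))) -addsmxE.
  rewrite -[X in (X <= _)%MS](addKr (a *: y)) addmx_sub //.
    by rewrite eqmx_opp (submx_trans yE) ?addsmxSl.
  by rewrite (submx_trans aE) ?addsmxSr.
have [A ->] := submxP vpE.
set p := _ *: y in Sp xiE ET EH vpE *.
(* The base point may change from [y] to [p] because [alpha] has constant coefficients. Both sides
   then carry the factor [\det A], leaving the hypothesis on [E]. *)
rewrite (alpha_mul theta y A) -[alpha theta y _]/(alphaN theta p E) EH.
rewrite /volume_form /cone_orientation -/p xiE wedge_cons_wedge !kdot_wedge.
rewrite trmx_mul mulmxA det_mulmx det_tr mulrC det_gram_col_mx //.
  exact/unit_sphere_dotv/Ssph.
by move=> i; exact: tangent_sphere_orthogonal (ET i).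
Qed.
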